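(* Let $\Omega=(a,b)$ with real numbers $a<b$. For all $u\in H^1(\Omega)$, all grid sizes $h$ and each degree $p\in\mathbb{N}$ with $h\,p<|\Omega|=b-a$, there is a spline approximation $u_{p,h}\in S_{p,h}(\Omega)$ such that $$\|u-u_{p,h}\|_{L^2(\Omega)}\le \sqrt{2}\,h\,|u|_{H^1(\Omega)}.$$
   Context: $\mathbb{N}=\{1,2,3,\ldots\}$. A grid size for $\Omega=(a,b)$ is a real $h>0$ such that $n_h:=h^{-1}(b-a)\in\mathbb{N}$. $L^2(\Omega)$ and $H^r(\Omega)$ are the standard Lebesgue and Sobolev spaces ($H^0=L^2$), and $|u|_{H^r(\Omega)}:=\|\frac{\partial^r}{\partial x^r}u\|_{L^2(\Omega)}$ is the seminorm. $\mathbb{P}^p$ is the space of polynomials of degree at most $p$. The space of splines of degree $p$ and maximum smoothness on the uniform grid of size $h$ is $$S_{p,h}(\Omega):=\{u\in H^p(\Omega): u|_{(a+hj,a+h(j+1)]}\in\mathbb{P}^p\text{ for all }j=0,\ldots,n_h-1\}$$ (for $p\ge1$ these are the $C^{p-1}$ functions that are polynomials of degree at most $p$ on each element). *)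

(* Defs.v *)
From HB Require Import structures.
From mathcomp Require Import all_boot all_order all_algebra.
From mathcomp Require Import all_classical all_reals all_analysis.
Set Implicit Arguments.
Unset Strict Implicit.
Unset Printing Implicit Defensive.
Import Order.TTheory GRing.Theory Num.Theory.
Import numFieldNormedType.Exports.
Local Open Scope classical_set_scope.
Local Open Scope ring_scope.

(* Elements of L^2(a, b) and H^r(a, b) are given by representatives
   [u : R -> R] that are Borel on ]a, b[. The values of [u] outside ]a, b[ are
   ignored: [u \_ `]a, b[] is the zero extension of the restriction of [u]. *)
Section sobolev.
Context {R : realType}.
Implicit Types (a b : R) (u v phi : R -> R) (r : nat).

Local Notation mu := (@lebesgue_measure R).

Definition L2norm a b u : \bar R :=
  ('N[mu]_2%:E [EFin \o (u \_ `]a, b[)])%E.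

Definition L2 a b : set (R -> R) :=
  [set u | u \_ `]a, b[ \in Lfun mu 2%:E].

Definition test_function a b : set (R -> R) :=
  [set phi | (forall n x, derivable (phi^`(n)%classic) x 1) /\
             compact (closure [set x | phi x != 0]) /\
             closure [set x | phi x != 0] `<=` `]a, b[ ].

Definition weak_derivative a b r u v : Prop :=
  forall phi, test_function a b phi ->
    \int[mu]_(x in `]a, b[) (u x * phi^`(r)%classic x) =
    (-1) ^+ r * \int[mu]_(x in `]a, b[) (v x * phi x).

(* The clause for [k = 0] always holds, with [v = u]; thus H^0 = L^2. *)
Definition sobolev a b r : set (R -> R) :=
  [set u | L2 a b u /\ forall k, (k <= r)%N ->
     exists v, L2 a b v /\ weak_derivative a b k u v].

(* A representative of the r-th weak derivative of [u]; it is unique a.e. on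
   ]a, b[. The default value 0 is only used when there is no L^2 one. *)
Definition weakD a b r u : R -> R :=
  xget (fun=> 0) [set v | L2 a b v /\ weak_derivative a b r u v].

Definition sobolev_seminorm a b r u : \bar R := L2norm a b (weakD a b r u).

End sobolev.

Section splines.
Context {R : realType}.
Implicit Types (a b h : R) (p : nat) (u : R -> R).

Definition grid_size a b h : Prop :=
  0 < h /\ exists2 n : nat, (0 < n)%N & h^-1 * (b - a) = n%:R.

(* The number of elements n_h; [Num.truncn] is exact when [h] is a grid size. *)
Definition grid_card a b h : nat := Num.truncn (h^-1 * (b - a)).

(* A spline is the representative that is polynomial everywhere on each
   half-open element. For p >= 1, membership in H^p then forces it to be the
   continuous representative on ]a, b[. *)
Definition spline a b p h : set (R -> R) :=
  [set u | sobolev a b p u /\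
    forall j, (j < grid_card a b h)%N ->
      exists q : {poly R}, (size q <= p.+1)%N /\
        forall x, x \in `]a + h * j%:R, a + h * j.+1%:R] -> u x = q.[x] ].

End splines.

(* Main.v *)
Require Import Defs.
From mathcomp Require Import all_boot all_order all_algebra.
From mathcomp Require Import all_classical all_reals all_analysis.
From mathcomp Require Import measurable_realfun ring lra.
Set Implicit Arguments.
Unset Strict Implicit.
Unset Printing Implicit Defensive.
Import Order.TTheory GRing.Theory Num.Theory.
Import numFieldNormedType.Exports.
Local Open Scope classical_set_scope.
Local Open Scope ring_scope.

(* Let K f (x) be the integral of f over ]a, x[. Up to null sets u = C + K v with
   v = u', and for p >= 1 the splines of degree p are the functions c + K t with
   t a spline of degree p - 1. By induction on p, the L^2 distance from K f to
   the splines of degree p is at most h |f|, uniformly in f. For p = 0 this is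
   Cauchy-Schwarz on each element. For the step, let s and t be the L^2
   projections of K f and f onto the splines of degree p and p - 1, and
   e = K f - s. Since e is orthogonal to K t and to constants, and the adjoint of
   K is -K on functions of mean zero,
     |e|^2 = <e, K (f - t)> = - <K e, f - t> = - <K e - w, f - t>
   for every spline w of degree p - 1, which is at most h |e| |f| for the best w.
   This gives the constant h instead of sqrt 2 h. *)

(** * Square integrable functions and orthogonal projections *)

(** The bound is carried by the projections themselves, because the step consumes their
    orthogonality: constants being splines of degree p >= 1 gives [e] mean zero, and [K t] being one
    removes [t] from the inner product. The induction hypothesis is used with [e] in the place of
    [f], which is why uniformity in [f] matters: it gives |K e - w| <= h |e|, and one factor |e|
    then cancels. The spline space enters as the span of a finite list, so that projections come
    from Gram-Schmidt. Two facts connect [K] with weak derivatives: c + K t has weak derivative t,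
    and u - K v is constant almost everywhere. Both use the adjoint identity of [K] on phi', which
    has mean zero and satisfies K phi' = phi. The second also needs a rich supply of test functions,
    and these are built from exp(-1/x). *)

Section square_integrable.
Context d (T : measurableType d) (R : realType).
Variable mu : {measure set T -> \bar R}.
Variables (D : set T) (mD : measurable D).
Implicit Types f g t : T -> R.

(** A real-valued form of square integrability on any measure space; [L2_sqintP] identifies it with
    [L2] on the interval. *)
Definition sqint f : Prop :=
  measurable_fun D f /\ mu.-integrable D (EFin \o (fun x => f x ^+ 2)).

Definition inner f g : R := \int[mu]_(x in D) (f x * g x).

Lemma integrableD_EFin f g : mu.-integrable D (EFin \o f) ->
  mu.-integrable D (EFin \o g) -> mu.-integrable D (EFin \o (fun x => f x + g x)).
Proof. exact: integrableD. Qed.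

Lemma sqint_mulr_integrable f g : sqint f -> sqint g ->
  mu.-integrable D (EFin \o (fun x => f x * g x)).
Proof.
move=> [mf if2] [mg ig2].
apply: (@le_integrable _ _ _ mu D mD _ (EFin \o (fun x => f x ^+ 2 + g x ^+ 2))) => //.
- by apply/measurable_EFinP; exact: measurable_funM.
- move=> x _ /=; rewrite lee_fin (le_trans _ (ler_norm _))// normrM.
  rewrite -[f x ^+ 2]real_normK ?num_real// -[g x ^+ 2]real_normK ?num_real//.
  by have := normr_ge0 (f x); have := normr_ge0 (g x); nra.
- exact: integrableD_EFin.
Qed.

Lemma sqintD f g : sqint f -> sqint g -> sqint (f \+ g).
Proof.
move=> [mf if2] [mg ig2]; split; first exact: measurable_funD.
apply: (@le_integrable _ _ _ mu D mD _
  (EFin \o (fun x => (f x ^+ 2 + f x ^+ 2) + (g x ^+ 2 + g x ^+ 2)))) => //.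
- by apply/measurable_EFinP; apply: measurable_funX; exact: measurable_funD.
- move=> x _ /=; rewrite lee_fin (le_trans _ (ler_norm _))// normrX.
  by rewrite real_normK ?num_real//=; have := sqr_ge0 (f x - g x); nra.
- by do ![apply: integrableD_EFin => //].
Qed.

Lemma sqintZ c f : sqint f -> sqint (c \*o f).
Proof.
move=> [mf if2]; split; first exact: measurable_funM.
rewrite (_ : _ \o _ = EFin \o (fun x => c ^+ 2 * f x ^+ 2)).
  exact: (integrableZl mD (c ^+ 2) if2).
by apply/funext => x /=; rewrite exprMn.
Qed.

Lemma sqintB f g : sqint f -> sqint g -> sqint (f \- g).
Proof.
move=> if2 ig2; rewrite (_ : _ \- _ = f \+ ((-1) \*o g)).
  by apply: sqintD => //; exact: sqintZ.
by apply/funext => x /=; rewrite mulN1r.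
Qed.

Lemma innerC f g : inner f g = inner g f.
Proof. by congr fine; apply: eq_integral => x _; rewrite mulrC. Qed.

Lemma innerDl f g t : sqint f -> sqint g -> sqint t ->
  inner (f \+ g) t = inner f t + inner g t.
Proof.
move=> hf hg ht; rewrite /inner -RintegralD//; last 2 first.
- exact: sqint_mulr_integrable.
- exact: sqint_mulr_integrable.
by congr fine; apply: eq_integral => x _; rewrite mulrDl.
Qed.

Lemma innerZl c f t : sqint f -> sqint t -> inner (c \*o f) t = c * inner f t.
Proof.
move=> hf ht; rewrite /inner -RintegralZl//; last exact: sqint_mulr_integrable.
by congr fine; apply: eq_integral => x _; rewrite mulrA.
Qed.

Lemma innerBl f g t : sqint f -> sqint g -> sqint t ->
  inner (f \- g) t = inner f t - inner g t.
Proof.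
move=> hf hg ht; rewrite /inner -RintegralB//; last 2 first.
- exact: sqint_mulr_integrable.
- exact: sqint_mulr_integrable.
by congr fine; apply: eq_integral => x _; rewrite mulrBl.
Qed.

Lemma innerDr f g t : sqint f -> sqint g -> sqint t ->
  inner t (f \+ g) = inner t f + inner t g.
Proof. by move=> *; rewrite innerC innerDl// !(innerC t). Qed.

Lemma innerBr f g t : sqint f -> sqint g -> sqint t ->
  inner t (f \- g) = inner t f - inner t g.
Proof. by move=> *; rewrite innerC innerBl// !(innerC t). Qed.

Lemma innerZr c f t : sqint f -> sqint t -> inner t (c \*o f) = c * inner t f.
Proof. by move=> *; rewrite innerC innerZl// (innerC t). Qed.

Lemma inner_ge0 f : 0 <= inner f f.
Proof. by apply: Rintegral_ge0 => x _; rewrite -expr2 sqr_ge0. Qed.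

(** The discriminant argument: the square norm of f + c g is a nonnegative quadratic in [c]. *)
Lemma cauchy_schwarz f g : sqint f -> sqint g ->
  inner f g ^+ 2 <= inner f f * inner g g.
Proof.
move=> hf hg.
have main c : 0 <= inner f f + c * inner f g *+ 2 + c ^+ 2 * inner g g.
  have hcg := sqintZ c hg.
  have := inner_ge0 (f \+ (c \*o g)).
  rewrite innerDl ?innerDr//; try exact: sqintD.
  rewrite innerZr// !innerZl// innerZr// (innerC g f).
  by congr (0 <= _); ring.
have [g0|] := eqVneq (inner g g) 0.
  have [->|fg0] := eqVneq (inner f g) 0; first by rewrite g0 mulr0 expr0n.
  (* Here the quadratic is affine in [c], and this [c] would give it the value -1. *)
  have := main (- (inner f f + 1) / inner f g / 2).
  rewrite g0 mulr0 addr0.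
  rewrite (_ : _ *+ _ = - (inner f f + 1)); last by field.
  by move=> ?; exfalso; lra.
move=> g0; have {g0}gp : 0 < inner g g by rewrite lt_neqAle eq_sym g0 inner_ge0.
(* The minimiser of the quadratic. *)
have := main (- inner f g / inner g g).
rewrite (_ : _ + _ = inner f f - inner f g ^+ 2 / inner g g); last first.
  by field; rewrite gt_eqF.
by rewrite subr_ge0 ler_pdivrMr.
Qed.

(** Equality of functions is meant at every point, not almost everywhere, since [spline] prescribes
    values everywhere on the half-open elements. The list may be linearly dependent. *)
Fixpoint lspan (s : seq (T -> R)) : set (T -> R) :=
  if s is g :: s' then [set f | exists c t, lspan s' t /\ f = (c \*o g) \+ t]
  else [set cst 0].

Lemma lspan0 s : lspan s (cst 0).
Proof.
elim: s => //= g s ih; exists 0, (cst 0); split=> //.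
by apply/funext => x /=; rewrite mul0r addr0.
Qed.

Lemma lspanS g s : lspan s `<=` lspan (g :: s).
Proof.
move=> t st; exists 0, t; split => //.
by apply/funext => x /=; rewrite mul0r add0r.
Qed.

Lemma lspan_head g s : lspan (g :: s) g.
Proof.
exists 1, (cst 0); split; first exact: lspan0.
by apply/funext => x /=; rewrite mul1r addr0.
Qed.

Lemma lspanD s f g : lspan s f -> lspan s g -> lspan s (f \+ g).
Proof.
elim: s f g => [|h s ih] f g /=.
  by move=> -> ->; apply/funext => x /=; rewrite addr0.
move=> [c [t [st ->]]] [c' [t' [st' ->]]]; exists (c + c'), (t \+ t').
by split; [exact: ih | apply/funext => x /=; ring].
Qed.

Lemma lspanZ s c f : lspan s f -> lspan s (c \*o f).
Proof.
elim: s f => [|h s ih] f /=.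
  by move=> ->; apply/funext => x /=; rewrite mulr0.
move=> [c' [t [st ->]]]; exists (c * c'), (c \*o t).
by split; [exact: ih | apply/funext => x /=; ring].
Qed.

(** One Gram-Schmidt step per entry: [e] is the part of [g] orthogonal to the span of the tail, and
    the projection of [f] onto the tail is corrected by a multiple of [e]. *)
Lemma projection s f : lspan s `<=` sqint -> sqint f ->
  exists2 p, lspan s p & forall t, lspan s t -> inner (f \- p) t = 0.
Proof.
elim: s f => [|g s ih] f sq hf.
  exists (cst 0) => // t ->.
  by rewrite /inner; under eq_Rintegral do rewrite mulr0; rewrite Rintegral_cst// mul0r.
have sqs : lspan s `<=` sqint by apply: subset_trans sq; exact: lspanS.
have hg : sqint g by apply: sq; exact: lspan_head.
have [p sp fp] := ih f sqs hf.
have [q sq' gq'] := ih g sqs hg.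
have hp := sqs _ sp; have hq := sqs _ sq'.
pose e := g \- q; have gq : forall t, lspan s t -> inner e t = 0 := gq'.
have he : sqint e by exact: sqintB.
have hfp : sqint (f \- p) by exact: sqintB.
(* [g] may be in the span of [s] up to a null set; then [c = 0] by the
   convention [x / 0 = 0], and [p] is still the projection. *)
pose c := inner (f \- p) e / inner e e.
have ce : inner (f \- p) e = c * inner e e.
  have [e0|e0] := eqVneq (inner e e) 0; last by rewrite /c divfK.
  have := cauchy_schwarz hfp he.
  rewrite e0 mulr0 => h; rewrite mulr0; apply/eqP; rewrite -sqrf_eq0.
  by rewrite eq_le h sqr_ge0.
exists (p \+ (c \*o e)).
  apply: lspanD; first exact: lspanS.
  apply: lspanZ; rewrite (_ : e = g \+ ((-1) \*o q)); last first.
    by apply/funext => x /=; rewrite mulN1r.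
  by apply: lspanD; [exact: lspan_head|apply: lspanS; exact: lspanZ].
move=> t [c' [t' [st' ->]]].
have ht' := sqs _ st'.
(* Splits the test function along [e] and the tail, which are orthogonal. *)
have -> : (c' \*o g) \+ t' = (c' \*o e) \+ ((c' \*o q) \+ t').
  by apply/funext => x /=; rewrite /e/=; ring.
have st'' : lspan s ((c' \*o q) \+ t') by apply: lspanD => //; exact: lspanZ.
have ht'' := sqs _ st''.
have -> : f \- (p \+ (c \*o e)) = (f \- p) \- (c \*o e).
  by apply/funext => x /=; ring.
have hce := sqintZ c he; have hc'e := sqintZ c' he.
have hr := sqintB hfp hce.
rewrite innerDr// !(innerBl hfp hce)// (fp _ st'') (innerZl _ he)//.
by rewrite !(innerZl _ he)// (gq _ st'') !innerZr// ce; ring.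
Qed.

End square_integrable.

(** * Integral operators with bounded kernel *)

Section bounded_kernel.
Context d (T : measurableType d) (R : realType).
Variable mu : {sigma_finite_measure set T -> \bar R}.
Variables (D : set T) (mD : measurable D).
Variables (k : T * T -> R) (mk : measurable_fun [set: T * T] k).
Hypothesis k1 : forall z, `|k z| <= 1.
Implicit Types f g : T -> R.

Lemma integrable_kernel f x : mu.-integrable D (EFin \o f) ->
  mu.-integrable D (EFin \o (fun y => k (x, y) * f y)).
Proof.
move=> fi; have mf := measurable_int _ fi.
apply: (@le_integrable _ _ _ mu D mD _ (EFin \o f)) => //.
- apply/measurable_EFinP; apply: measurable_funM; last exact/measurable_EFinP.
  apply: measurable_funTS; exact: measurable_fun_pair2.
- by move=> y _ /=; rewrite lee_fin normrM ler_piMl.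
Qed.

Lemma integrable_kernel_sym f y : mu.-integrable D (EFin \o f) ->
  mu.-integrable D (EFin \o (fun x => k (x, y) * f x)).
Proof.
move=> fi; have mf := measurable_int _ fi.
apply: (@le_integrable _ _ _ mu D mD _ (EFin \o f)) => //.
- apply/measurable_EFinP; apply: measurable_funM; last exact/measurable_EFinP.
  apply: measurable_funTS; exact: measurable_fun_pair1.
- by move=> x _ /=; rewrite lee_fin normrM ler_piMl.
Qed.

(** The integrand of the double integral, extended by zero so that Fubini applies on the whole
    product space. *)
Let F f g (z : T * T) : \bar R := ((g \_ D) z.1 * (k z * (f \_ D) z.2))%:E.

Let integrableT f : mu.-integrable D (EFin \o f) ->
  mu.-integrable setT (EFin \o (f \_ D)).
Proof. by move=> ?; rewrite -restrict_EFin; apply/integrable_restrict; rewrite ?setTI. Qed.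

Let mF f g : mu.-integrable D (EFin \o f) -> mu.-integrable D (EFin \o g) ->
  measurable_fun setT (F f g).
Proof.
move=> /integrableT/measurable_int/measurable_EFinP mf.
move=> /integrableT/measurable_int/measurable_EFinP mg.
apply/measurable_EFinP; apply: measurable_funM.
  exact: measurableT_comp mg (@measurable_fst _ _ _ _).
by apply: measurable_funM => //; exact: measurableT_comp mf (@measurable_snd _ _ _ _).
Qed.

(** Since |k| <= 1, the integrand is dominated by |g(x)| |f(y)|, whose iterated integral is the
    product of the two L^1 norms. *)
Let intF f g : mu.-integrable D (EFin \o f) -> mu.-integrable D (EFin \o g) ->
  (mu \x mu)%E.-integrable setT (F f g).
Proof.
move=> fi gi; apply/integrable12ltyP; first exact: mF.
have fT := integrableT fi; have gT := integrableT gi.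
have mfT : measurable_fun setT (f \_ D) by apply/measurable_EFinP; exact: measurable_int fT.
have mgT : measurable_fun setT (g \_ D) by apply/measurable_EFinP; exact: measurable_int gT.
pose N := (\int[mu]_y `|((f \_ D) y)%:E|)%E.
have Nfin : N \is a fin_num.
  by rewrite ge0_fin_numE ?integral_ge0//; case/integrableP : fT.
apply: (@le_lt_trans _ _ (\int[mu]_x (`|((g \_ D) x)%:E| * N))%E); last first.
  rewrite ge0_integralZr//; last 2 first.
  - by apply: measurableT_comp => //; exact/measurable_EFinP.
  - exact: integral_ge0.
  rewrite lte_mul_pinfty//; first exact: integral_ge0.
    rewrite ge0_fin_numE ?integral_ge0//; case/integrableP : gT => _; exact.
  by move: Nfin; rewrite ge0_fin_numE ?integral_ge0.
apply: ge0_le_integral => //.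
- by move=> x _; exact: integral_ge0.
- apply: (measurable_fun_fubini_tonelli_F (abse \o F f g)) => //=.
  by apply: measurableT_comp => //; exact: mF.
- apply: emeasurable_funM => //; apply: measurableT_comp => //.
  exact/measurable_EFinP.
- move=> x _; rewrite /N -ge0_integralZl//; last first.
    by apply: measurableT_comp => //; exact/measurable_EFinP.
  apply: ge0_le_integral => //.
  + apply: measurableT_comp => //.
    by apply: measurable_fun_pair2 => //; exact: mF.
  + apply: measurable_funeM; apply: measurableT_comp => //; exact/measurable_EFinP.
  + move=> y _; rewrite /F/= lee_fin normrM ler_wpM2l//.
    by rewrite normrM ler_piMl.
Qed.

Let iter_l f g x : mu.-integrable D (EFin \o f) ->
  (\int[mu]_y F f g (x, y) =
   (((fun x => g x * (\int[mu]_(y in D) (k (x, y) * f y))%R) \_ D) x)%:E)%E.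
Proof.
move=> fi; rewrite patchE/= /F/= patchE; case: ifPn => _; last first.
  by under eq_integral do rewrite mul0r; rewrite integral0.
under eq_integral do rewrite EFinM.
rewrite integralZl//; last first.
  rewrite (_ : (fun y => _) = EFin \o ((fun y => k (x, y) * f y) \_ D)).
    by apply: integrableT; exact: integrable_kernel.
  by apply/funext => y /=; rewrite !patchE; case: ifPn => //; rewrite mulr0.
rewrite EFinM; congr (_ * _)%E.
rewrite Rintegral_mkcond fineK; last first.
  by apply: integrable_fin_num => //; apply: integrableT; exact: integrable_kernel.
apply: eq_integral => y _; congr EFin.
by rewrite !patchE; case: ifPn => //; rewrite mulr0.
Qed.

Let iter_r f g y : mu.-integrable D (EFin \o g) ->
  (\int[mu]_x F f g (x, y) =
   (((fun y => f y * (\int[mu]_(x in D) (k (x, y) * g x))%R) \_ D) y)%:E)%E.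
Proof.
move=> gi; rewrite patchE/= /F/= patchE; case: ifPn => _; last first.
  by under eq_integral do rewrite mulr0 mulr0; rewrite integral0.
under eq_integral do rewrite mulrA [(_ * _ * f y)%R]mulrC EFinM.
rewrite integralZl//; last first.
  rewrite (_ : (fun x => _) = EFin \o ((fun x => k (x, y) * g x) \_ D)).
    by apply: integrableT; exact: integrable_kernel_sym.
  by apply/funext => x /=; rewrite !patchE; case: ifPn => //; rewrite (mul0r, mulrC).
rewrite EFinM; congr (_ * _)%E.
rewrite Rintegral_mkcond fineK; last first.
  by apply: integrable_fin_num => //; apply: integrableT; exact: integrable_kernel_sym.
apply: eq_integral => x _; congr EFin.
by rewrite !patchE; case: ifPn => //; rewrite (mul0r, mulrC).
Qed.

(** The adjoint of an integral operator has the transposed kernel. This serves both the adjoint of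
    [primitive] and the counting of overlapping windows in the case of degree 0. *)
Lemma kernel_swap f g :
  mu.-integrable D (EFin \o f) -> mu.-integrable D (EFin \o g) ->
  \int[mu]_(x in D) (g x * \int[mu]_(y in D) (k (x, y) * f y)) =
  \int[mu]_(y in D) (f y * \int[mu]_(x in D) (k (x, y) * g x)).
Proof.
move=> fi gi; have := Fubini (intF fi gi).
under eq_integral do rewrite iter_l//.
under [in RHS]eq_integral do rewrite iter_r//.
by move=> /(congr1 fine) fgE; rewrite [LHS]Rintegral_mkcond [RHS]Rintegral_mkcond.
Qed.

(** Fubini also delivers measurability of the inner integral in [x]; this is how primitives are
    shown to be measurable. *)
Lemma integrable_mul_kernel f g :
  mu.-integrable D (EFin \o f) -> mu.-integrable D (EFin \o g) ->
  mu.-integrable D (EFin \o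
    (fun x => g x * \int[mu]_(y in D) (k (x, y) * f y))).
Proof.
move=> fi gi; have := integrable_fubini_F (intF fi gi).
rewrite /fubini_F; under eq_fun do rewrite iter_l//.
rewrite -[X in mu.-integrable _ X]/(EFin \o _) -restrict_EFin.
by move/integrable_restrict; rewrite setTI; apply.
Qed.

End bounded_kernel.

(** * Integration from the left endpoint *)

Section primitive.
Variable R : realType.
Variables a b : R.
Local Notation mu := (@lebesgue_measure R).
Local Notation D := (`]a, b[%classic : set R).
Local Notation sq := (sqint mu D).
Local Notation ip := (inner mu D).
Implicit Types f g t : R -> R.

(** The upper limit is moved into an indicator, so that this is an operator with a kernel bounded by
    1 on a fixed domain; [primitiveE] recovers the usual form. *)
Definition primitive f x : R := \int[mu]_(y in D) ((y < x)%R%:R * f y).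
Local Notation K := primitive.

Let mD : @measurable _ (measurableTypeR R) D := measurable_itv _.

Let k (z : R * R) : R := (z.2 < z.1)%R%:R.

Lemma measurable_boolR d (T : measurableType d) (P : T -> bool) :
  measurable_fun setT P -> measurable_fun setT (fun x => (P x)%:R : R).
Proof.
move=> mP; rewrite (_ : (fun x => _) = fun x => if P x then 1 else 0); last first.
  by apply/funext => x; case: (P x).
exact: measurable_fun_ifT.
Qed.

Let mk : measurable_fun [set: R * R] k.
Proof.
by apply: measurable_boolR; apply: measurable_fun_ltr.
Qed.

Let k1 z : `|k z| <= 1.
Proof. by rewrite /k; case: (_ < _)%R; rewrite /= ?normr1// normr0. Qed.

Lemma sqint_cst c : sq (cst c).
Proof.
split=> //; apply: measurable_bounded_integrable => //=.
  by rewrite lebesgue_measure_itv/=; case: ifPn => _; rewrite ?ltry// -EFinD ltry.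
exact: bounded_cst.
Qed.

(** [D] has finite measure, so the constant 1 is square integrable and can be the second factor. *)
Lemma sqint_integrable f : sq f -> mu.-integrable D (EFin \o f).
Proof.
move=> hf; have := sqint_mulr_integrable mD hf (sqint_cst 1).
by apply: eq_integrable => // x _ /=; rewrite mulr1.
Qed.

Lemma integrable_lt f x : mu.-integrable D (EFin \o f) ->
  mu.-integrable D (EFin \o (fun y => (y < x)%R%:R * f y)).
Proof. by move=> fi; exact: (integrable_kernel mD mk k1). Qed.

Lemma integrable_primitive f : mu.-integrable D (EFin \o f) ->
  mu.-integrable D (EFin \o K f).
Proof.
move=> fi.
have := integrable_mul_kernel mD mk k1 fi (sqint_integrable (sqint_cst 1)).
by apply: eq_integrable => // x _ /=; rewrite mul1r.
Qed.

(** With the weight [g] of [integrable_mul_kernel] taken to be [K f] itself, the integrable product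
    is the square of [K f]. *)
Lemma sqint_primitive f : sq f -> sq (K f).
Proof.
move=> /sqint_integrable fi; have Kfi := integrable_primitive fi.
split; first by apply/measurable_EFinP; exact: measurable_int Kfi.
exact: (integrable_mul_kernel mD mk k1 fi Kfi).
Qed.

Lemma primitiveD f g : sq f -> sq g -> K (f \+ g) = K f \+ K g.
Proof.
move=> /sqint_integrable fi /sqint_integrable gi; apply/funext => x /=.
rewrite /K -RintegralD//; [|exact: integrable_lt..].
by apply: eq_Rintegral => y _; rewrite mulrDr.
Qed.

Lemma primitiveZ c f : sq f -> K (c \*o f) = c \*o K f.
Proof.
move=> /sqint_integrable fi; apply/funext => x /=.
rewrite /K -RintegralZl//; last exact: integrable_lt.
by apply: eq_Rintegral => y _; rewrite mulrCA.
Qed.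

Lemma primitiveB f g : sq f -> sq g -> K (f \- g) = K f \- K g.
Proof.
move=> /sqint_integrable fi /sqint_integrable gi; apply/funext => x /=.
rewrite /K -RintegralB//; [|exact: integrable_lt..].
by apply: eq_Rintegral => y _; rewrite mulrBr.
Qed.

Lemma primitiveE f x : x <= b -> K f x = \int[mu]_(y in `]a, x[) f y.
Proof.
move=> xb; rewrite /K Rintegral_mkcond [RHS]Rintegral_mkcond.
apply: eq_Rintegral => y _; rewrite !patchE !mem_setE !in_itv/=.
have [ay|] := ltP a y => //=; have [yx|xy] := ltP y x.
  by rewrite (lt_le_trans yx xb) mul1r.
by rewrite mul0r if_same.
Qed.

Lemma primitive_compl f y : D y -> mu.-integrable D (EFin \o f) ->
  \int[mu]_(x in D) ((y < x)%R%:R * f x) = \int[mu]_(x in D) f x - K f y.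
Proof.
rewrite /= in_itv/= => /andP[ay yb] fi; rewrite primitiveE ?ltW//.
rewrite (@Rintegral_itv_bndo_bndc _ _ y f); last first.
by apply: integrableS fi => //; apply: subset_itvl; rewrite bnd_simp ltW.
rewrite Rintegral_itvB//; [|by rewrite bnd_simp ltW..].
rewrite [LHS]Rintegral_mkcond [RHS]Rintegral_mkcond.
apply: eq_Rintegral => x _; rewrite !patchE !mem_setE !in_itv/=.
have [xb|] := ltP x b; rewrite ?andbT ?andbF//; have [yx|xy] := ltP y x.
  by rewrite (lt_trans ay yx) mul1r.
by rewrite mul0r if_same.
Qed.

(* The adjoint of integration from the left is integration from the right, and
   the two differ only by a sign on functions of mean zero. *)
Lemma inner_primitive e f : sq e -> sq f -> ip e (cst 1) = 0 ->
  ip e (K f) = - ip (K e) f.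
Proof.
move=> he hf e1.
have ei := sqint_integrable he; have fi := sqint_integrable hf.
rewrite /inner [LHS](kernel_swap mD mk k1 fi ei).
rewrite -mulN1r -RintegralZl//; last first.
  by apply: sqint_mulr_integrable => //; exact: sqint_primitive.
apply: eq_Rintegral => y /[!inE] yD.
rewrite (primitive_compl yD)//.
have -> : \int[mu]_(x in D) e x = 0.
  by rewrite -[RHS]e1; apply: eq_Rintegral => x _; rewrite mulr1.
by rewrite sub0r mulrN mulN1r mulrC.
Qed.

(** Linearity of [K]; the hypothesis supplies the integrability under which [K] is additive. *)
Lemma lspan_primitive s f : lspan s `<=` sq ->
  lspan [seq K g | g <- s] f <-> exists2 t, lspan s t & f = K t.
Proof.
elim: s f => [|g s ih] f hs /=.
  split=> [->|[t -> ->]].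
    exists (cst 0) => //; apply/funext => x /=.
    by rewrite /K; under eq_Rintegral do rewrite mulr0; rewrite Rintegral_cst// mul0r.
  apply/funext => x /=.
  by rewrite /K; under eq_Rintegral do rewrite mulr0; rewrite Rintegral_cst// mul0r.
have hss : lspan s `<=` sq by apply: subset_trans hs; exact: lspanS.
have hg : sq g by apply: hs; exact: lspan_head.
split=> [[c [t' [/(ih _ hss)[t st ->] ->]]]|[_ [c [t [st ->]]] ->]].
  exists ((c \*o g) \+ t); first by exists c, t.
  by rewrite primitiveD ?primitiveZ//; [exact: sqintZ|exact: hss].
exists c, (K t); split; first by apply/(ih _ hss); exists t.
by rewrite primitiveD ?primitiveZ//; [exact: sqintZ|exact: hss].
Qed.

Lemma lspan_sum (I : Type) (F : I -> R -> R) (c : I -> R) (s : seq I) :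
  lspan [seq F j | j <- s] (fun x => \sum_(j <- s) c j * F j x).
Proof.
elim: s => [|i s ih] /=; first by apply/funext => x; rewrite big_nil.
exists (c i), (fun x => \sum_(j <- s) c j * F j x); split => //.
by apply/funext => x; rewrite big_cons.
Qed.

Lemma lspan_sub s (P : set (R -> R)) : P (cst 0) ->
  (forall c f g, P f -> P g -> P ((c \*o f) \+ g)) ->
  (forall g, List.In g s -> P g) -> lspan s `<=` P.
Proof.
move=> P0 PD; elim: s => [|g s ih] Ps f /=; first by move=> ->.
move=> [c [t [st ->]]]; apply: PD; first by apply: Ps; left.
by apply: ih st => h sh; apply: Ps; right.
Qed.

End primitive.

(** * Approximation of primitives by splines *)

Section spline_basis.
Variable R : realType.
Variables a b h : R.
Variables (n : nat) (h0 : 0 < h) (nh : a + h * n%:R = b).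
Local Notation mu := (@lebesgue_measure R).
Local Notation D := (`]a, b[%classic : set R).
Local Notation sq := (sqint mu D).
Local Notation ip := (inner mu D).
Local Notation K := (primitive a b).
Implicit Types f g t : R -> R.

Let mD : @measurable _ (measurableTypeR R) D := measurable_itv _.

Definition node j : R := a + h * j%:R.

Definition element j (x : R) : R := (x \in `]node j, node j.+1])%:R.

(** Iterated primitives of the element indicators, with a constant of integration added at each
    level. The list has n + p entries, the dimension of the space of smoothest splines. *)
Fixpoint spline_basis (p : nat) : seq (R -> R) :=
  if p is p'.+1 then cst 1 :: [seq K g | g <- spline_basis p']
  else [seq element j | j <- iota 0 n].

Lemma sqint_bool (P : R -> bool) : measurable_fun [set: measurableTypeR R] P ->
  sq (fun x => (P x)%:R).
Proof.
move=> mP.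
have mPR : measurable_fun setT (fun x => (P x)%:R : R) := measurable_boolR mP.
split; first exact: measurable_funTS.
apply: measurable_bounded_integrable => //=.
- by rewrite lebesgue_measure_itv/=; case: ifPn => _; rewrite ?ltry// -EFinD ltry.
- by apply: measurable_funTS; exact: measurable_funX.
- exists 1; split; first exact: num_real.
  move=> M M1 x _ /=; rewrite ger0_norm ?sqr_ge0//.
  by case: (P x); rewrite /= ?expr1n ?expr0n ltW// (lt_trans _ M1).
Qed.

Lemma measurable_mem_itv (i : interval R) :
  measurable_fun [set: measurableTypeR R] (fun x => x \in i).
Proof.
apply: (measurable_fun_bool true); rewrite setTI.
rewrite (_ : _ @^-1` _ = [set` i]); first exact: measurable_itv.
by apply/seteqP; split => x /=.
Qed.

(** An inequality only, because the interval may stick out of [D]. *)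
Lemma integral_mem_itv (l r : R) : l <= r ->
  \int[mu]_(x in D) (x \in `[l, r])%:R <= r - l.
Proof.
move=> lr; rewrite (_ : (fun x => _) = \1_(`[l, r]%classic)); last first.
  by apply/funext => x; rewrite indicE mem_setE.
rewrite /Rintegral integral_indic//.
have itvE : mu `[l, r] = (r - l)%:E.
  rewrite lebesgue_measure_itv/= lte_fin; case: ltP => // rl.
  by rewrite (_ : r = l) ?subrr//; apply/le_anti/andP.
have le_itv : (mu (`[l, r] `&` D) <= (r - l)%:E)%E.
  rewrite -itvE; apply: le_measure; rewrite ?inE; last exact: subIsetl.
    by apply: measurableI => //; exact: measurable_itv.
  exact: measurable_itv.
by rewrite -lee_fin fineK// ge0_fin_numE//; exact: le_lt_trans le_itv (ltry _).
Qed.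

Lemma spline_basis_sqint p : lspan (spline_basis p) `<=` sq.
Proof.
apply: lspan_sub; first exact: sqint_cst.
- by move=> c f g hf hg; apply: sqintD => //; exact: sqintZ.
- elim: p => [|p ih] g /=.
    move=> /List.in_map_iff[j [<- _]]; apply: sqint_bool.
    exact: measurable_mem_itv.
  move=> [<-|/List.in_map_iff[g' [<- g'p]]]; first exact: sqint_cst.
  by apply: sqint_primitive; exact: ih.
Qed.

Lemma spline_basisS p f : lspan (spline_basis p.+1) f <->
  exists c t, lspan (spline_basis p) t /\ f = (c \*o cst 1) \+ K t.
Proof.
have hp := @spline_basis_sqint p.
split=> [[c [_ [/(lspan_primitive _ hp)[t pt ->] ->]]]|[c [t [pt ->]]]].
  by exists c, t.
by exists c, (K t); split => //; apply/lspan_primitive => //; exists t.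
Qed.

Lemma element_exists x : D x -> exists2 j, (j < n)%N & x \in `]node j, node j.+1].
Proof.
rewrite /= in_itv/= => /andP[ax xb].
have n0 : (0 < n)%N.
  by rewrite lt0n; apply: contraTneq (lt_trans ax xb) => n0; rewrite -nh n0 mulr0 addr0 ltxx.
have Pn : exists j, x <= node j.+1 by exists n.-1; rewrite prednK// /node nh ltW.
(* The first element whose right node is at or beyond [x]; minimality puts its left node strictly
   before [x]. *)
exists (ex_minn Pn); case: ex_minnP => j xj jmin.
  by rewrite -(prednK n0) ltnS jmin// prednK// /node nh ltW.
rewrite in_itv/= xj andbT; case: j xj jmin => [|j] xj jmin.
  by rewrite /node mulr0 addr0.
by rewrite ltNge; apply/negP => /jmin; rewrite ltnn.
Qed.

Lemma element_unique i j x :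
  x \in `]node i, node i.+1] -> x \in `]node j, node j.+1] -> i = j.
Proof.
rewrite !in_itv/= => /andP[ix xi] /andP[jx xj].
have := lt_le_trans ix xj; have := lt_le_trans jx xi.
rewrite /node !ltrD2l !ltr_pM2l// !ltr_nat !ltnS => ji ij.
by apply/eqP; rewrite eqn_leq ij ji.
Qed.

Lemma sum_elementE (c : nat -> R) j x : (j < n)%N -> x \in `]node j, node j.+1] ->
  \sum_(i <- iota 0 n) c i * element i x = c j.
Proof.
move=> jn xj; rewrite (bigD1_seq j) ?iota_uniq ?mem_iota//= {1}/element xj mulr1.
rewrite big1 ?addr0// => i ij; rewrite /element.
case: (boolP (_ \in _)) => xi; last by rewrite mulr0.
by move: ij; rewrite (element_unique xi xj) eqxx.
Qed.

(** Cauchy-Schwarz on [y, x[, whose length is at most [h]. The window is then enlarged to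
    [x - h, x], which no longer depends on [y], so that one kernel serves all elements. *)
Lemma sqr_primitiveB f x y : sq f -> y <= x <= y + h ->
  (K f x - K f y) ^+ 2 <=
  h * \int[mu]_(z in D) ((z \in `[x - h, x])%:R * f z ^+ 2).
Proof.
move=> hf /andP[yx xyh]; pose r z : R := (z \in `[y, x[)%:R.
have sr : sq r by apply: sqint_bool; exact: measurable_mem_itv.
have fi := sqint_integrable hf.
have sqf2 (i : interval R) : mu.-integrable D (EFin \o (fun z => (z \in i)%:R * f z ^+ 2)).
  have mi : measurable_fun D (fun z => (z \in i)%:R : R).
    by have [] : sq (fun z => (z \in i)%:R) by apply: sqint_bool; exact: measurable_mem_itv.
  apply: (@le_integrable _ _ _ mu D mD _ (EFin \o (fun z => f z ^+ 2))) => //.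
  - apply/measurable_EFinP; apply: measurable_funM => //.
    by apply: measurable_funX; case: hf.
  - move=> z _ /=; rewrite lee_fin normrM ler_piMl//.
    by case: (z \in i); rewrite /= ?normr1 ?normr0.
  - by case: hf.
have srf : sq (r \* f).
  split; first by apply: measurable_funM; [case: sr|case: hf].
  apply: eq_integrable (sqf2 `[y, x[) => // z _ /=.
  by rewrite exprMn /r; case: (z \in _); rewrite /= ?expr1n ?expr0n.
(* The indicator is idempotent; keeping a copy of it on [f] makes Cauchy-Schwarz see only the part
   of [f] in the window. *)
have -> : K f x - K f y = ip r (r \* f).
  rewrite /K/primitive -RintegralB//; [|exact: integrable_lt..].
  apply: eq_Rintegral => z _; rewrite /r /= !in_itv/= mulrA -mulrBl; congr (_ * _).
  have [yz|zy] := leP y z; have [zx|xz] := ltP z x; rewrite /= ?mulr1 ?mulr0 ?subr0 ?subrr//.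
  by move: (le_lt_trans xz zy); rewrite ltNge yx.
apply: (le_trans (cauchy_schwarz mD sr srf)).
have rr : ip r r <= h.
  apply: (@le_trans _ _ (x - y)); last by lra.
  apply: le_trans (integral_mem_itv yx); apply: le_Rintegral => //.
  - exact: sqint_mulr_integrable.
  - by apply: sqint_integrable; apply: sqint_bool; exact: measurable_mem_itv.
  - move=> z _; rewrite /r !in_itv/= -expr2.
    case: ltP => [/ltW ->|]; rewrite ?andbT ?andbF/= ?expr0n//.
    by case: (y <= z); rewrite ?expr1n ?expr0n.
apply: ler_pM => //.
- exact: inner_ge0.
- exact: inner_ge0.
- apply: le_Rintegral => //; first exact: sqint_mulr_integrable.
  move=> z _ /=; rewrite -expr2 exprMn; apply: ler_wpM2r; first exact: sqr_ge0.
  rewrite /r !in_itv/=; have [yz|] := leP y z; last by rewrite expr0n.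
  have -> : x - h <= z by lra.
  by case: ltP => [/ltW ->|]; rewrite /= ?expr1n// expr0n.
Qed.

(** [w] takes the value of [K f] at the left node of each element. One factor [h] comes from
    [sqr_primitiveB]; the other appears after exchanging the integrals, since a point y lies in the
    window of x only for x in [y, y + h]. *)
Lemma piecewise_constant_bound f : sq f ->
  exists2 w, lspan (spline_basis 0) w &
    ip (K f \- w) (K f \- w) <= h ^+ 2 * ip f f.
Proof.
move=> hf; pose w x := \sum_(i <- iota 0 n) K f (node i) * element i x.
have lw : lspan (spline_basis 0) w by exact: lspan_sum.
exists w => //; have sw := spline_basis_sqint lw.
pose k (z : measurableTypeR R * measurableTypeR R) : R := (z.1 - h <= z.2 <= z.1)%R%:R.
have mk : measurable_fun setT k.
  apply: measurable_boolR; apply: measurable_and; apply: measurable_fun_ler => //.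
  exact: measurable_funB.
have k1 z : `|k z| <= 1.
  by rewrite /k; case: (_ <= _ <= _)%R; rewrite /= ?normr1 ?normr0.
have f2i : mu.-integrable D (EFin \o (fun x => f x ^+ 2)) by case: hf.
have ci : mu.-integrable D (EFin \o cst h) by apply: sqint_integrable; exact: sqint_cst.
apply: (@le_trans _ _ (\int[mu]_(x in D) (h * \int[mu]_(z in D) (k (x, z) * f z ^+ 2)))).
  apply: le_Rintegral => //.
  - by apply: sqint_mulr_integrable => //; apply: sqintB => //; exact: sqint_primitive.
  - exact: (integrable_mul_kernel mD mk k1 f2i ci).
  - move=> x xD /=; have [j jn xj] := element_exists xD.
    rewrite /w (sum_elementE _ jn xj) -expr2.
    have -> : (fun z => k (x, z) * f z ^+ 2) = (fun z => (z \in `[x - h, x])%:R * f z ^+ 2).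
      by apply/funext => z; rewrite in_itv.
    apply: sqr_primitiveB => //; move: xj; rewrite in_itv/= => /andP[jx xj].
    by rewrite ltW//=; move: xj; rewrite /node -natr1; lra.
rewrite (kernel_swap mD mk k1 f2i ci) -RintegralZl//.
apply: le_Rintegral => //.
- have /= := integrable_mul_kernel mD (k := fun z => k (z.2, z.1)).
  apply => //; apply: (measurableT_comp mk); exact: measurable_swap.
- have /= := integrableZl mD (h ^+ 2) f2i.
  by apply: eq_integrable.
- move=> y yD; rewrite mulrC; apply: ler_wpM2r; first exact: sqr_ge0.
  have -> : (fun x => k (x, y) * cst h x) = (fun x => (x \in `[y, y + h])%:R * h).
    apply/funext => x; rewrite /k in_itv/=; congr (_%:R * _); congr nat_of_bool.
    by rewrite andbC; congr andb; rewrite lerBlDr.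
  rewrite RintegralZr//; last first.
    by apply: sqint_integrable; apply: sqint_bool; exact: measurable_mem_itv.
  rewrite ler_pM2r//; have yh : y <= y + h by rewrite lerDl ltW.
  by apply: le_trans (integral_mem_itv yh) _; rewrite addrC addKr.
Qed.

(** The projection [s] is characterised by orthogonality and [f] is universally quantified, so that
    the hypothesis for the lower degree applies to [e] and the projection [w] of [K e]. *)
Lemma spline_projection_bound p f s : sq f -> lspan (spline_basis p) s ->
  (forall t, lspan (spline_basis p) t -> ip (K f \- s) t = 0) ->
  ip (K f \- s) (K f \- s) <= h ^+ 2 * ip f f.
Proof.
have sp q : lspan (spline_basis q) `<=` sq by exact: spline_basis_sqint.
elim: p f s => [|p ih] f s hf ls orth;
  have hKf := sqint_primitive hf; have hs := sp _ _ ls;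
  set e := K f \- s in orth *; have he : sq e by exact: sqintB.
(* By Pythagoras the projection is at least as close to [K f] as [w]. *)
- have [w lw wf] := piecewise_constant_bound hf.
  have hw := sp _ _ lw; apply: le_trans wf.
  have hsw : sq (s \- w) by exact: sqintB.
  have lsw : lspan (spline_basis 0) (s \- w).
    rewrite (_ : s \- w = s \+ ((-1) \*o w)).
      by apply: lspanD => //; exact: lspanZ.
    by apply/funext => x /=; rewrite mulN1r.
  rewrite (_ : K f \- w = e \+ (s \- w)); last first.
    by apply/funext => x; rewrite /e/=; ring.
  have hes : sq (e \+ (s \- w)) by exact: sqintD.
  rewrite (innerDr mD he hsw hes) (innerDl mD he hsw he) (innerDl mD he hsw hsw).
  by rewrite (innerC mu D (s \- w) e) (orth _ lsw) addr0 add0r lerDl inner_ge0.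
- have [t lt ft] := projection mD (sp p) hf.
  have [w lw wK] := projection mD (sp p) (sqint_primitive he).
  have ht := sp _ _ lt; have hw := sp _ _ lw.
  have bound := ih _ _ he lw wK.
  have hft : sq (f \- t) by exact: sqintB.
  have hKe : sq (K e) by exact: sqint_primitive.
  have e1 : ip e (cst 1) = 0 by apply: orth; exact: lspan_head.
  have eKt : ip e (K t) = 0.
    apply: orth; apply/spline_basisS; exists 0, t; split => //.
    by apply/funext => x /=; rewrite mul0r add0r.
  (* Both [s] and [K t] are orthogonal to [e], so [e] may be replaced by K (f - t) in one argument;
     [w] enters freely because f - t is orthogonal to it. *)
  have ee : ip e e = - ip (K e \- w) (f \- t).
    transitivity (ip e (K (f \- t))).
      rewrite primitiveB// (innerBr mD hKf (sqint_primitive ht) he) eKt subr0.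
      by rewrite {2}/e (innerBr mD hKf hs he) (orth _ ls) subr0.
    by rewrite inner_primitive// (innerBl mD hKe hw hft) (innerC mu D w) (ft _ lw) subr0.
  have fft : ip (f \- t) (f \- t) <= ip f f.
    rewrite [X in _ <= ip X X](_ : f = (f \- t) \+ t); last first.
      by apply/funext => x /=; ring.
    have hftt : sq ((f \- t) \+ t) by exact: sqintD.
    rewrite (innerDr mD hft ht hftt) (innerDl mD hft ht hft) (innerDl mD hft ht ht).
    by rewrite (innerC mu D t) (ft _ lt) addr0 add0r lerDl inner_ge0.
  (* Cauchy-Schwarz in squared form, with [bound] and [fft] for the two factors; one factor [ip e e]
     is divided out below. *)
  have ee2 : ip e e ^+ 2 <= h ^+ 2 * ip e e * ip f f.
    rewrite ee sqrrN; apply: le_trans (cauchy_schwarz mD _ hft) _.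
      exact: sqintB.
    rewrite -ee; apply: ler_pM => //; exact: inner_ge0.
  have [->|e0] := eqVneq (ip e e) 0.
    by rewrite mulr_ge0 ?sqr_ge0 ?inner_ge0.
  have {e0}ep : 0 < ip e e by rewrite lt_neqAle eq_sym e0 inner_ge0.
  by move: ee2; rewrite expr2 [h ^+ 2 * _]mulrC -mulrA ler_pM2l.
Qed.

End spline_basis.

(** * Fundamental theorem of calculus and integration by parts *)

Section ftc.
Variable R : realType.
Local Notation mu := (@lebesgue_measure R).
Implicit Types (f F : R -> R) (a b l r x : R).

Lemma derivable_continuous f : (forall x, derivable f x 1) -> continuous f.
Proof. by move=> df x; apply/differentiable_continuous/derivable1_diffP. Qed.

Lemma continuous_integrable_oo f l r : continuous f ->
  mu.-integrable `]l, r[ (EFin \o f).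
Proof.
move=> cf; apply: (@integrableS _ _ _ mu `[l, r]%classic) => //.
  exact: subset_itv_oo_cc.
apply: continuous_compact_integrable; first exact: segment_compact.
by apply: continuous_subspaceT.
Qed.

Lemma continuous_sqint f a b : continuous f -> sqint mu `]a, b[ f.
Proof.
move=> cf; split; first by apply: measurable_funTS; exact: continuous_measurable_fun.
by apply: continuous_integrable_oo => x; apply: cvgM; exact: cf.
Qed.

Lemma Rintegral_derive f F l r : l <= r -> continuous f ->
  (forall x, is_derive x (1 : R) F (f x)) ->
  \int[mu]_(x in `]l, r[) f x = F r - F l.
Proof.
rewrite le_eqVlt => /predU1P[->|lr] cf dF.
  by rewrite set_itv_ge ?bnd_simp ?ltxx// Rintegral_set0 subrr.
have dFx x : derivable F x 1 by have [] := dF x.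
have cF := derivable_continuous dFx.
have ioo := continuous_integrable_oo l r cf.
rewrite Rintegral_itv_bndo_bndc// Rintegral_itv_obnd_cbnd//; last first.
  apply: (@integrableS _ _ _ mu `]l, (r + 1)[%classic) => //.
  - by apply: subset_itvl; rewrite bnd_simp ltrDl.
  - exact: continuous_integrable_oo.
rewrite /Rintegral (@continuous_FTC2 _ _ F)//.
- exact: continuous_subspaceT.
- split; [by move=> x _|exact: cvg_at_right_filter (cF l)|exact: cvg_at_left_filter (cF r)].
- by move=> x _; rewrite derive1E; have dFx' := dF x; exact: derive_val.
Qed.

Lemma poly_antiderivative (q : {poly R}) :
  exists2 Q : {poly R}, Q^`() = q & (size Q <= (size q).+1)%N.
Proof.
(* At i = 0 the coefficient is a division by zero, hence 0. *)
exists (\poly_(i < (size q).+1) (q`_i.-1 / i%:R)); last exact: size_poly.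
apply/polyP => i; rewrite coef_deriv coef_poly ltnS.
have [iq|qi] := ltnP; first by rewrite -[LHS]mulr_natr divfK// pnatr_eq0.
by rewrite mul0rn nth_default.
Qed.

End ftc.

Section test_functions.
Variables (R : realType) (a b : R).
Hypothesis ab : a < b.
Local Notation mu := (@lebesgue_measure R).
Local Notation D := (`]a, b[%classic : set R).
Local Notation sq := (sqint mu D).
Local Notation ip := (inner mu D).
Local Notation K := (primitive a b).
Implicit Types (f t phi : R -> R).

Let mD : @measurable _ (measurableTypeR R) D := measurable_itv _.

Lemma test_function_out phi x : test_function a b phi -> ~ D x -> phi x = 0.
Proof.
move=> [_ [_ sub]] xD; apply/eqP/negP => /negP phix; apply: xD.
by apply: sub; exact: subset_closure.
Qed.

(** The complement of the support is open, so [phi] vanishes near each of its points and its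
    derivative vanishes there too. *)
Lemma test_function_derive1 phi : test_function a b phi ->
  test_function a b (phi^`()%classic).
Proof.
move=> [dphi [cphi sub]].
have subs : closure [set x | phi^`()%classic x != 0] `<=` closure [set x | phi x != 0].
  rewrite [X in _ `<=` X]((closure_id _).1 (@closed_closure _ _)).
  apply: closure_subset => x /= phix; apply: contrapT => xc.
  move/eqP: phix; apply.
  rewrite derive1E.
  have : open (~` closure [set x | phi x != 0]).
    by rewrite openC; exact: closed_closure.
  move=> /(_ _ xc) nx.
  rewrite (@near_eq_derive _ _ _ _ (cst 0)); first exact: derive_cst.
  apply: filterS nx => y yc; apply/eqP/negP => /negP yphi.
  by apply: yc; exact: subset_closure.
split; [|split].
- by move=> n x; rewrite -derive1Sn; exact: dphi.
- by apply: subclosed_compact cphi subs; exact: closed_closure.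
- exact: subset_trans subs sub.
Qed.

Lemma test_function_derive1n phi n : test_function a b phi ->
  test_function a b (phi^`(n)%classic).
Proof.
by move=> tphi; elim: n => [|n ih] //; rewrite derive1nS; exact: test_function_derive1.
Qed.

Lemma test_function_continuous phi : test_function a b phi -> continuous phi.
Proof. by move=> [dphi _]; apply: derivable_continuous; exact: (dphi 0%N). Qed.

Lemma test_function_sqint phi : test_function a b phi -> sq phi.
Proof. by move=> /test_function_continuous; exact: continuous_sqint. Qed.

Lemma test_function_is_derive phi x : test_function a b phi ->
  is_derive x (1 : R) phi (phi^`()%classic x).
Proof.
by move=> [dphi _]; rewrite derive1E; apply: DeriveDef => //; exact: (dphi 0%N).
Qed.

Lemma primitive_derive1 phi x : test_function a b phi -> D x ->
  K (phi^`()%classic) x = phi x.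
Proof.
move=> tphi; have t1 := test_function_derive1 tphi.
rewrite /= in_itv/= => /andP[ax xb]; rewrite primitiveE ?ltW//.
rewrite (Rintegral_derive _ _ (fun y => test_function_is_derive y tphi)) ?ltW//.
- by rewrite (test_function_out (x := a) tphi) ?subr0//= in_itv/= ltxx.
- exact: test_function_continuous.
Qed.

Lemma integral_derive1 phi : test_function a b phi ->
  ip (phi^`()%classic) (cst 1) = 0.
Proof.
move=> tphi; have t1 := test_function_derive1 tphi.
rewrite /inner; under eq_Rintegral do rewrite mulr1.
rewrite (Rintegral_derive _ _ (fun y => test_function_is_derive y tphi)) ?ltW//.
- rewrite (test_function_out (x := a) tphi)/= ?in_itv/= ?ltxx//.
  by rewrite (test_function_out (x := b) tphi)/= ?in_itv/= ?ltxx ?andbF// subr0.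
- exact: test_function_continuous.
Qed.

(** The adjoint identity applied to phi': it has mean zero, which also removes the constant, and its
    primitive is [phi] on [D]. *)
Lemma primitive_ibp c t phi : test_function a b phi -> sq t ->
  ip ((c \*o cst 1) \+ K t) (phi^`()%classic) = - ip t phi.
Proof.
move=> tphi ht; have t1 := test_function_derive1 tphi.
have h1 := test_function_sqint t1.
have hc1 : sq (c \*o cst 1) by apply: sqintZ => //; exact: sqint_cst.
rewrite (innerDl mD hc1 (sqint_primitive ht) h1).
rewrite (innerZl mD _ (sqint_cst a b 1) h1) (innerC mu D (cst 1)).
rewrite integral_derive1// mulr0 add0r innerC inner_primitive//; last exact: integral_derive1.
congr (- _); rewrite innerC; apply: eq_Rintegral => x /[!inE] xD.
by rewrite primitive_derive1.
Qed.

End test_functions.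

(** * From the span of the basis to the spline space *)

Section L2_sqint.
Variables (R : realType) (a b : R).
Local Notation mu := (@lebesgue_measure R).
Local Notation D := (`]a, b[%classic : set R).
Local Notation sq := (sqint mu D).
Local Notation ip := (inner mu D).
Implicit Types (f t : R -> R).

Let mD : @measurable _ (measurableTypeR R) D := measurable_itv _.

Lemma sqr_patch f : (fun x => (f \_ D) x ^+ 2) = (fun x => f x ^+ 2) \_ D.
Proof. by apply/funext => x; rewrite !patchE; case: ifPn; rewrite // expr0n. Qed.

Lemma L2normE f : sq f -> L2norm a b f = (Num.sqrt (ip f f))%:E.
Proof.
move=> [mf fi]; rewrite /L2norm unlock.
have -> : (\int[mu]_x `|(EFin \o f \_ D) x| `^ 2 = (ip f f)%:E)%E.
  rewrite /inner Rintegral_mkcond fineK; last first.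
    apply: integrable_fin_num => //.
    by rewrite -[X in _.-integrable _ X]/(EFin \o _) -restrict_EFin;
       apply/integrable_restrict => //; rewrite setTI.
  apply: eq_integral => x _; rewrite /= powR_mulrn ?normr_ge0//.
  by rewrite real_normK ?num_real// !patchE; case: ifPn; rewrite // expr0n.
by rewrite poweR_EFin powR12_sqrt// inner_ge0.
Qed.

Lemma L2_sqintP f : L2 a b f <-> sq f.
Proof.
split=> [|hf].
- rewrite /L2/= => fL; split.
    apply/(measurable_restrictT _ mD).
    by move: fL; rewrite inE => /andP[/[!inE]].
  have := Lfun2_integrable_sqr fL.
  rewrite sqr_patch -restrict_EFin => /integrable_restrict.
  by rewrite setTI; apply.
- rewrite /L2/= inE/=; apply/andP; split; rewrite inE/=.
    by case: hf => mf _; exact/(measurable_restrictT _ mD).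
  by rewrite /finite_norm; have := L2normE hf; rewrite /L2norm => ->; rewrite ltry.
Qed.

End L2_sqint.

Section spline_membership.
Variables (R : realType) (a b h : R) (n : nat).
Hypotheses (ab : a < b) (h0 : 0 < h) (nh : a + h * n%:R = b).
Local Notation mu := (@lebesgue_measure R).
Local Notation D := (`]a, b[%classic : set R).
Local Notation sq := (sqint mu D).
Local Notation K := (primitive a b).
Local Notation basis := (spline_basis a b h n).

(** Each differentiation strips one primitive and lowers the degree by one; the integration by parts
    is tested on the k-th derivative of [phi], again a test function. *)
Lemma spline_basis_weak_derivative p k s : (k <= p)%N -> lspan (basis p) s ->
  exists2 v, sq v & weak_derivative a b k s v.
Proof.
elim: k p s => [|k ih] p s.
  move=> _ ls; exists s; first exact: spline_basis_sqint ls.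
  by move=> phi _; rewrite expr0 mul1r.
case: p => // p; rewrite ltnS => kp /spline_basisS[c [t [lt ->]]].
have [v hv tv] := ih _ _ kp lt.
exists v => // phi tphi; rewrite derive1nS.
have ht := spline_basis_sqint lt.
rewrite [LHS](primitive_ibp ab c (test_function_derive1n k tphi) ht).
by rewrite /inner tv// exprS mulN1r mulNr.
Qed.

Lemma primitive_piecewise (t : R -> R) j (q : {poly R}) p : sq t -> (j < n)%N ->
  (size q <= p)%N ->
  (forall x, x \in `]node a h j, node a h j.+1] -> t x = q.[x]) ->
  exists q' : {poly R}, (size q' <= p.+1)%N /\
    forall x, x \in `]node a h j, node a h j.+1] -> K t x = q'.[x].
Proof.
move=> ht jn qp tq; have [Q Qq sQ] := poly_antiderivative q.
have ti := sqint_integrable ht.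
(* The antiderivative that agrees with [K t] at the left node. *)
exists (Q + (K t (node a h j) - Q.[node a h j])%:P); split.
  rewrite (leq_trans (size_polyD _ _))// geq_max (leq_trans sQ)//=.
  by rewrite (leq_trans (size_polyC_leq1 _)).
move=> x /[dup] xj; rewrite in_itv/= => /andP[jx xj1].
have aj : a <= node a h j by rewrite /node lerDl mulr_ge0// ltW.
have xb : x <= b.
  by rewrite (le_trans xj1)// -nh /node lerD2l ler_pM2l// ler_nat.
have txi : mu.-integrable `]a, x[ (EFin \o t).
  by apply: integrableS ti => //; apply: subset_itvl; rewrite bnd_simp.
rewrite hornerD hornerC !primitiveE//; last exact: le_trans (ltW jx) xb.
rewrite (Rintegral_itv_bndo_bndc (r := node a h j)); last first.
  by apply: integrableS txi => //; apply: subset_itvl; rewrite bnd_simp ltW.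
have := Rintegral_itvB txi (x := node a h j).
rewrite !bnd_simp => /(_ aj jx).
have -> : \int[mu]_(y in `]node a h j, x[) t y = Q.[x] - Q.[node a h j].
  transitivity (\int[mu]_(y in `]node a h j, x[) q.[y]).
    apply: eq_Rintegral => y; rewrite inE/= in_itv/= => /andP[jy yx].
    by apply: tq; rewrite in_itv/= jy (le_trans (ltW yx)).
  apply: Rintegral_derive; [exact: ltW|exact: continuous_horner|].
  by move=> y; rewrite -Qq; exact: is_derive_poly.
by move=> /eqP; rewrite subr_eq => /eqP ->; ring.
Qed.

Lemma spline_basis_piecewise p s j : lspan (basis p) s -> (j < n)%N ->
  exists q : {poly R}, (size q <= p.+1)%N /\
    forall x, x \in `]node a h j, node a h j.+1] -> s x = q.[x].
Proof.
move=> + jn; elim: p s => [|p ih] s.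
  apply: (@lspan_sub R _ [set f | exists q : {poly R}, (size q <= 1)%N /\
    forall x, x \in `]node a h j, node a h j.+1] -> f x = q.[x]]).
  - by exists 0; split=> [|x _]; rewrite ?size_poly0 ?horner0.
  - move=> c f g [qf [sf ef]] [qg [sg eg]]; exists (c *: qf + qg); split.
      by rewrite (leq_trans (size_polyD _ _))// geq_max sg (leq_trans (size_scale_leq _ _)).
    by move=> x xj /=; rewrite hornerD hornerZ ef// eg.
  - move=> _ /List.in_map_iff[i [<- _]]; have [<-|ij] := eqVneq i j.
      exists 1; rewrite size_poly1; split => // x xi.
      by rewrite hornerC /element xi.
    exists 0; rewrite size_poly0; split => // x xj; rewrite horner0 /element.
    case: (boolP (_ \in _)) => // xi.
    by move: ij; rewrite (element_unique h0 xi xj) eqxx.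
move=> /spline_basisS[c [t [lt ->]]].
have [q [sq qt]] := ih _ lt.
have [q' [sq' q't]] := primitive_piecewise (spline_basis_sqint lt) jn sq qt.
exists (c%:P + q'); split.
  rewrite (leq_trans (size_polyD _ _))// geq_max sq' andbT.
  by rewrite (leq_trans (size_polyC_leq1 _)).
by move=> x xj /=; rewrite hornerD hornerC q't// mulr1.
Qed.

Lemma spline_basis_spline p s : lspan (basis p) s -> spline a b p h s.
Proof.
move=> ls; split; first split.
- by apply/L2_sqintP; exact: spline_basis_sqint ls.
- move=> k kp; have [v hv sv] := spline_basis_weak_derivative kp ls.
  by exists v; split => //; apply/L2_sqintP.
- have -> : grid_card a b h = n.
    rewrite /grid_card -nh addrAC subrr add0r mulKf ?gt_eqF//.
    exact: Num.Theory.natrK.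
  by move=> j jn; exact: spline_basis_piecewise.
Qed.

End spline_membership.

(** * Test functions and the du Bois-Reymond lemma *)

Section flat_functions.
Variable R : realType.
Implicit Types (f g : R -> R) (x c d : R) (n : nat).

(** The classical smooth function exp(-1/x), with the powers of 1/x that differentiation produces,
    so that the derivatives stay in the linear span of the family. *)
Definition flat n x : R := if 0 < x then (x^-1) ^+ n * expR (- x^-1) else 0.

Lemma flat_le0 n x : x <= 0 -> flat n x = 0.
Proof. by rewrite /flat ltNge => ->. Qed.

Lemma flat_ge0 n x : 0 <= flat n x.
Proof.
rewrite /flat; case: ifPn => // x0.
by rewrite mulr_ge0 ?expR_ge0// exprn_ge0// invr_ge0 ltW.
Qed.

Lemma flat0_le1 x : flat 0 x <= 1.
Proof.
rewrite /flat; case: ifPn => // x0; rewrite expr0 mul1r.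
by rewrite -[leRHS]expR0 ler_expR oppr_le0 invr_ge0 ltW.
Qed.

(** From exp y >= y^(n+2) / (n+2)! at y = 1/x. Two powers of [x] suffice for a zero derivative at
    0. *)
Lemma flat_quadratic n x : flat n x <= n.+2`!%:R * x ^+ 2.
Proof.
rewrite /flat; case: ifPn => x0; last by rewrite mulr_ge0 ?sqr_ge0.
have y0 : 0 < x^-1 by rewrite invr_gt0.
have := expR_ge1Dxn n.+1 (ltW y0); rewrite expRN => h.
have {}h : x^-1 ^+ n.+2 / n.+2`!%:R <= expR x^-1.
  by apply: le_trans h; rewrite lerDr.
rewrite ler_pdivrMr ?expR_gt0//.
have fn0 : 0 < n.+2`!%:R :> R by rewrite ltr0n fact_gt0.
rewrite ler_pdivrMr// in h.
have -> : x^-1 ^+ n = x^-1 ^+ n.+2 * x ^+ 2.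
  by rewrite -addn2 exprD -mulrA -exprMn mulVf ?gt_eqF// expr1n mulr1.
by rewrite [leRHS]mulrAC ler_pM2r ?exprn_gt0// mulrC.
Qed.

Lemma is_derive_quadratic f C : f 0 = 0 -> (forall x, `|f x| <= C * x ^+ 2) ->
  is_derive (0 : R) (1 : R) f 0.
Proof.
move=> f0 fC.
suff fd : h^-1 *: (f (h *: 1 + 0) - f 0) @[h --> 0^'] --> (0 : R).
  apply: DeriveDef; first by apply/cvg_ex; exists 0.
  by apply/cvg_lim.
apply/cvgrPdist_le => e e0; near=> t.
have t0 : t != 0 by near: t; exact: nbhs_dnbhs_neq.
rewrite sub0r normrN f0 subr0 addr0 [t *: _]mulr1 /GRing.scale/= normrM normfV.
rewrite mulrC ler_pdivrMr ?normr_gt0//; apply: (le_trans (fC t)).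
rewrite -[t ^+ 2]real_normK ?num_real// expr2 mulrA ler_wpM2r//.
apply: (@le_trans _ _ ((`|C| + 1) * `|t|)).
  by apply: ler_wpM2r => //; rewrite (le_trans (ler_norm C))// lerDl.
rewrite mulrC -ler_pdivlMr; last by rewrite ltr_pwDr.
by near: t; apply: dnbhs0_le; rewrite divr_gt0// ltr_pwDr.
Unshelve. all: by end_near. Qed.

Lemma is_derive_flat n x :
  is_derive x (1 : R) (flat n) (flat n.+2 x - n%:R * flat n.+1 x).
Proof.
have [x0|x0|->] := ltgtP x 0.
- rewrite !flat_le0 ?ltW// mulr0 subr0.
  apply: (@near_eq_is_derive _ _ _ (cst 0)).
  near=> y; rewrite flat_le0// ltW//; near: y; exact: lt_nbhsl.
- have dV : is_derive x 1 (fun y : R => y^-1) (- x ^- 2 * 1).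
    by apply: is_deriveV; rewrite gt_eqF.
  have dN : is_derive x 1 (fun y : R => - y^-1) (x ^- 2).
    by rewrite -[X in is_derive _ _ _ X]opprK -[X in - X]mulr1; apply: is_deriveN.
  have dE : is_derive x 1 (expR \o (fun y : R => - y^-1)) (expR (- x^-1) * x ^- 2).
    exact: is_derive1_comp.
  have dX := is_deriveX n dV.
  have dM := is_deriveM dX dE.
  have nflat : \near x, ((fun y : R => y^-1) ^+ n * (expR \o (fun y : R => - y^-1))) x = flat n x.
    near=> y; rewrite /flat ifT; last by near: y; exact: lt_nbhsr.
    by rewrite mulrfctE exprfctE.
  apply: (is_derive_eq (near_eq_is_derive nflat dM)).
  rewrite /flat x0 /GRing.scale/= exprfctE !exprS.
  case: n {dX dM nflat} => [|n] /=.
    by rewrite !expr0; field; rewrite gt_eqF.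
  by rewrite !exprS; field; rewrite gt_eqF.
- rewrite !flat_le0// mulr0 subr0.
  apply: (@is_derive_quadratic _ n.+2`!%:R); first by rewrite flat_le0.
  by move=> y; rewrite ger0_norm ?flat_ge0// flat_quadratic.
Unshelve. all: by end_near. Qed.

(* Being closed under differentiation, this class consists of smooth functions. *)
Inductive flat_algebra : (R -> R) -> Prop :=
| flat_algebra_flat n c d : flat_algebra (fun x => flat n (c * x + d))
| flat_algebraD f g : flat_algebra f -> flat_algebra g -> flat_algebra (f \+ g)
| flat_algebraZ c f : flat_algebra f -> flat_algebra (c \*o f)
| flat_algebraM f g : flat_algebra f -> flat_algebra g -> flat_algebra (f \* g).

Lemma flat_algebra_is_derive f : flat_algebra f ->
  exists2 g, flat_algebra g & forall x, is_derive x (1 : R) f (g x).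
Proof.
elim=> [n c d|{}f g _ [f' sf' df] _ [g' sg' dg]|c {}f _ [f' sf' df]
  |{}f g sf [f' sf' df] sg [g' sg' dg]].
- exists (c \*o ((fun x => flat n.+2 (c * x + d)) \+
    (- n%:R \*o (fun x => flat n.+1 (c * x + d))))).
    by apply: flat_algebraZ; apply: flat_algebraD; [|apply: flat_algebraZ];
      exact: flat_algebra_flat.
  move=> x.
  have dl : is_derive x 1 (fun y : R => c * y + d) c.
    rewrite -[X in is_derive _ _ _ X]addr0 -[X in X + 0]mulr1.
    exact: (is_deriveD (is_deriveZ c (is_derive_id x 1)) (is_derive_cst d x 1)).
  have := @is_derive1_comp _ _ (fun y => c * y + d) x _ _ (is_derive_flat n (c * x + d)) dl.
  by move=> h; apply: (is_derive_eq h); rewrite /=; ring.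
- by exists (f' \+ g'); [exact: flat_algebraD|move=> x; exact: is_deriveD].
- by exists (c \*o f'); [exact: flat_algebraZ|move=> x; exact: is_deriveZ].
- exists ((f \* g') \+ (g \* f')).
    by apply: flat_algebraD; exact: flat_algebraM.
  by move=> x; exact: is_deriveM.
Qed.

Lemma flat_algebra_smooth f n x : flat_algebra f -> derivable (f^`(n)%classic) x 1.
Proof.
elim: n f => [|n ih] f sf.
  by have [g _ dg] := flat_algebra_is_derive sf; case: (dg x).
have [g sg dg] := flat_algebra_is_derive sf.
rewrite derive1Sn (_ : f^`()%classic = g); first exact: ih.
by apply/funext => y; have dgy := dg y; rewrite derive1E; exact: derive_val.
Qed.

Lemma flat_algebra_continuous f : flat_algebra f -> continuous f.
Proof.
move=> sf; apply: derivable_continuous => x.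
by have := @flat_algebra_smooth f 0%N x sf.
Qed.

(** The argument y tends to infinity, and 1 - exp(-1/y) <= 1/y. *)
Lemma flat_cvg c d : 0 < c -> flat 0 (c * k.+1%:R + d) @[k --> \oo] --> (1 : R).
Proof.
move=> c0; apply/cvgrPdist_le => e e0; near=> k.
have ky : e^-1 <= c * k.+1%:R + d.
  rewrite -lerBlDr mulrC -ler_pdivrMr// -natr1 -lerBlDr.
  by near: k; exact: nbhs_infty_ger.
have y0 : 0 < c * k.+1%:R + d by apply: lt_le_trans ky; rewrite invr_gt0.
rewrite ger0_norm ?subr_ge0 ?flat0_le1// /flat y0 expr0 mul1r lerBlDr -lerBlDl.
apply: le_trans (expR_ge1Dx _); rewrite lerD2l lerN2.
by rewrite -[leRHS]invrK lef_pV2// posrE invr_gt0.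
Unshelve. all: by end_near. Qed.

End flat_functions.

Section du_bois_reymond.
Variables (R : realType) (a b : R).
Hypothesis ab : a < b.
Local Notation mu := (@lebesgue_measure R).
Local Notation D := (`]a, b[%classic : set R).
Implicit Types (f g w phi : R -> R) (c : R) (k : nat).

Let mD : @measurable _ (measurableTypeR R) D := measurable_itv _.

(* [bump k c] is smooth, vanishes outside [a + 1/(k+1), c], and converges
   boundedly to the indicator of ]a, c[. *)
Definition bump k c (x : R) : R :=
  flat 0 (k.+1%:R * x + (- k.+1%:R * a - 1)) *
  flat 0 (- k.+1%:R * x + k.+1%:R * c).

Lemma bump_flat_algebra k c : flat_algebra (bump k c).
Proof. exact: (flat_algebraM (flat_algebra_flat _ _ _) (flat_algebra_flat _ _ _)). Qed.

Lemma bump_ge0 k c x : 0 <= bump k c x.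
Proof. by rewrite mulr_ge0 ?flat_ge0. Qed.

Lemma bump_le1 k c x : bump k c x <= 1.
Proof. by rewrite mulr_ile1 ?flat_ge0 ?flat0_le1. Qed.

Lemma bump_eq0 k c x : ~~ (a + k.+1%:R^-1 < x < c) -> bump k c x = 0.
Proof.
rewrite negb_and -!leNgt => /orP[xa|cx]; rewrite /bump.
  rewrite flat_le0 ?mul0r// addrA subr_le0 mulNr -mulrBr.
  by rewrite -ler_pdivlMl// mulr1 lerBlDl.
rewrite [X in _ * X]flat_le0 ?mulr0// addrC mulNr -mulrBr.
by rewrite pmulr_rle0// subr_le0.
Qed.

Lemma bump_cvg c x : bump k c x @[k --> \oo] --> ((x \in `]a, c[)%:R : R).
Proof.
have [xac|] := boolP (x \in _); last first.
  rewrite in_itv/= => xac; apply: cvg_near_cst; apply: nearW => k.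
  apply: bump_eq0; apply: contra xac => /andP[ax ->]; rewrite andbT.
  by apply: lt_trans ax; rewrite ltrDl invr_gt0.
move: xac; rewrite in_itv/= => /andP[ax xc].
rewrite -[X in _ --> X](mulr1 1); apply: cvgM.
  rewrite (_ : (fun k => _) = fun k => flat 0 ((x - a) * k.+1%:R + - 1)).
    by apply: flat_cvg; rewrite subr_gt0.
  by apply/funext => k; congr flat; ring.
rewrite (_ : (fun k => _) = fun k => flat 0 ((c - x) * k.+1%:R + 0)).
  by apply: flat_cvg; rewrite subr_gt0.
by apply/funext => k; congr flat; ring.
Qed.

Lemma integrable_mul_bounded w f : mu.-integrable D (EFin \o w) ->
  measurable_fun D f -> (forall x, `|f x| <= 1) ->
  mu.-integrable D (EFin \o (fun x => w x * f x)).
Proof.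
move=> wi mf f1; apply: (@le_integrable _ _ _ mu D mD _ (EFin \o w)) => //.
- apply/measurable_EFinP; apply: measurable_funM => //.
  by apply/measurable_EFinP; exact: measurable_int wi.
- by move=> x _ /=; rewrite lee_fin normrM ler_piMr.
Qed.

Lemma bump_norm_le1 k c x : `|bump k c x| <= 1.
Proof. by rewrite ger0_norm ?bump_ge0 ?bump_le1. Qed.

Lemma measurable_bump k c : measurable_fun D (bump k c).
Proof.
apply: measurable_funTS; apply: continuous_measurable_fun.
exact: flat_algebra_continuous (bump_flat_algebra k c).
Qed.

Lemma measurable_itv_bool c : measurable_fun D (fun x : R => (x \in `]a, c[)%:R : R).
Proof. by have [] := sqint_bool a b (measurable_mem_itv `]a, c[). Qed.

Lemma bump_integral_cvg w c : mu.-integrable D (EFin \o w) ->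
  \int[mu]_(x in D) (w x * bump k c x) @[k --> \oo] -->
  \int[mu]_(x in D) (w x * (x \in `]a, c[)%:R).
Proof.
move=> wi.
have wbi k := integrable_mul_bounded wi (measurable_bump k c) (@bump_norm_le1 k c).
have wci : mu.-integrable D (EFin \o (fun x => w x * (x \in `]a, c[)%:R)).
  apply: integrable_mul_bounded => //; first exact: measurable_itv_bool.
  by move=> x; case: (x \in _); rewrite /= ?normr1 ?normr0.
apply: fine_cvg; rewrite fineK; last exact: integrable_fin_num.
apply: (@dominated_cvg _ _ _ mu D mD
  (fun k x => (w x * bump k c x)%:E) _ (fun x => `|w x|%:E)) => //.
- by move=> k; exact: measurable_int (wbi k).
- move=> x _; apply: cvg_EFin; first exact: nearW.
  by apply: cvgM; [exact: cvg_cst|exact: bump_cvg].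
- exact: integrable_norm.
- by move=> k x _; rewrite /= lee_fin normrM ler_piMr// bump_norm_le1.
Qed.

(** The primitive of [g] from [a] vanishes up to [l], and beyond [r] it equals the total integral;
    mean zero therefore gives it compact support. *)
Lemma flat_algebra_primitive g l r : flat_algebra g -> a < l -> r < b ->
  (forall x, ~~ (l < x < r) -> g x = 0) -> \int[mu]_(x in D) g x = 0 ->
  exists2 phi, test_function a b phi & phi^`()%classic = g.
Proof.
move=> fg al rb g0 intg0.
have cg := flat_algebra_continuous fg.
pose phi x := \int[mu]_(y in `[a, x]) g y.
have phil x : x <= l -> phi x = 0.
  move=> xl; rewrite /phi (@eq_Rintegral _ _ _ _ _ (cst 0)) ?Rintegral_cst ?mul0r//.
  move=> y; rewrite inE/= in_itv/= => /andP[ay yx]; rewrite g0// negb_and.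
  by rewrite -leNgt (le_trans yx).
have phir x : r <= x -> phi x = 0.
  move=> rx; rewrite -intg0 /phi [LHS]Rintegral_mkcond [RHS]Rintegral_mkcond.
  apply: eq_Rintegral => y _; rewrite !patchE !mem_setE !in_itv/=.
  have [lyr|] := boolP (l < y < r); last by move=> /g0 ->; rewrite !if_same.
  case/andP: lyr => ly yr.
  by rewrite (lt_trans al ly) (ltW (lt_trans al ly)) (lt_trans yr rb) (ltW (lt_le_trans yr rx)).
have dphi x : is_derive x (1 : R) phi (g x).
  (* The fundamental theorem covers the points beyond [a]; the others lie before [l], where [phi] is
     locally zero. *)
  have [ax|xa] := ltP a x.
    have ig : mu.-integrable `[a, x + 1] (EFin \o g).
      apply: continuous_compact_integrable; first exact: segment_compact.
      exact: continuous_subspaceT.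
    have x1 : x < x + 1 by rewrite ltrDl.
    have [d1 d2] := continuous_FTC1_closed x1 ig ax (cg x).
    by apply: (DeriveDef d1); rewrite -derive1E; exact: d2.
  have xl : x < l by exact: le_lt_trans al.
  rewrite g0; last by rewrite negb_and -leNgt (ltW xl).
  apply: (@near_eq_is_derive _ _ _ (cst 0)).
  near=> y; rewrite phil// ltW//; near: y; exact: lt_nbhsl.
have phi1 : phi^`()%classic = g.
  by apply/funext => x; have dx := dphi x; rewrite derive1E; exact: derive_val.
exists phi => //; split.
  move=> [|n] x; first by case: (dphi x).
  by rewrite derive1Sn phi1; exact: flat_algebra_smooth.
have sub : closure [set x | phi x != 0] `<=` `[l, r]%classic.
  rewrite [X in _ `<=` X]((closure_id _).1 (@interval_closed _ (BLeft l) (BRight r) isT isT)).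
  apply: closure_subset => x /= phix; rewrite in_itv/=.
  apply/andP; split; rewrite leNgt; apply: contra phix => h; apply/eqP.
    by apply: phil; exact: ltW.
  by apply: phir; exact: ltW.
split.
  apply: subclosed_compact (@segment_compact _ l r) sub.
  exact: closed_closure.
apply: subset_trans sub _ => x /=; rewrite !in_itv/= => /andP[lx xr].
by rewrite (lt_le_trans al lx) (le_lt_trans xr rb).
Unshelve. all: by end_near. Qed.

Lemma integral_itv_bool c : D c ->
  \int[mu]_(x in D) (cst 1 x * (x \in `]a, c[)%:R) = c - a.
Proof.
rewrite /= in_itv/= => /andP[ac cb].
transitivity (\int[mu]_(x in `]a, c[) (1 : R)).
  rewrite [LHS]Rintegral_mkcond [RHS]Rintegral_mkcond.
  apply: eq_Rintegral => x _; rewrite !patchE !mem_setE !in_itv/=.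
  have [xc|] := ltP x c; rewrite ?andbT ?andbF/=; last by rewrite mulr0 if_same.
  rewrite (lt_trans xc cb) andbT; case: ifP => // ->; by rewrite mulr1.
rewrite Rintegral_cst; last exact: measurable_itv.
rewrite mul1r -[RHS]/(fine (c - a)%:E); congr fine.
by rewrite [LHS]lebesgue_measure_itv/= lte_fin ac.
Qed.

(** Two bumps weighted crosswise by their masses have a difference of mean zero, which is the
    derivative of a test function and so is annihilated by [w]. The product form avoids dividing by
    a mass. *)
Lemma weakly_constant_bump w k c c' : mu.-integrable D (EFin \o w) ->
  (forall phi, test_function a b phi ->
    \int[mu]_(x in D) (w x * phi^`()%classic x) = 0) ->
  D c -> D c' ->
  \int[mu]_(x in D) (cst 1 x * bump k c' x) * \int[mu]_(x in D) (w x * bump k c x) =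
  \int[mu]_(x in D) (cst 1 x * bump k c x) * \int[mu]_(x in D) (w x * bump k c' x).
Proof.
move=> wi wphi; rewrite /= !in_itv/= => /andP[ac cb] /andP[ac' c'b].
have oi : mu.-integrable D (EFin \o cst 1).
  by apply: sqint_integrable; exact: sqint_cst.
have bi d : mu.-integrable D (EFin \o (fun x => cst 1 x * bump k d x)).
  by apply: integrable_mul_bounded => //;
    [exact: measurable_bump|exact: bump_norm_le1].
have wbi d : mu.-integrable D (EFin \o (fun x => w x * bump k d x)).
  by apply: integrable_mul_bounded => //;
    [exact: measurable_bump|exact: bump_norm_le1].
have ib r d : mu.-integrable D (EFin \o (fun x => r * (cst 1 x * bump k d x))).
  exact: (integrableZl mD r (bi d)).
have iwb r d : mu.-integrable D (EFin \o (fun x => r * (w x * bump k d x))).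
  exact: (integrableZl mD r (wbi d)).
have [m mE] : exists m, \int[mu]_(x in D) (cst 1 x * bump k c x) = m by eexists.
have [m' m'E] : exists m', \int[mu]_(x in D) (cst 1 x * bump k c' x) = m' by eexists.
pose g := (m' \*o bump k c) \+ (- m \*o bump k c').
have fg : flat_algebra g.
  by apply: flat_algebraD; apply: flat_algebraZ; exact: bump_flat_algebra.
have ig : \int[mu]_(x in D) g x = 0.
  transitivity (\int[mu]_(x in D) (m' * (cst 1 x * bump k c x) - m * (cst 1 x * bump k c' x))).
    by apply: eq_Rintegral => x _; rewrite /g/= !mul1r mulNr.
  rewrite (RintegralB mD (ib m' c) (ib m c')).
  by rewrite (RintegralZl m' mD (bi c)) (RintegralZl m mD (bi c')) mE m'E mulrC subrr.
have [|||phi tphi phi1] := flat_algebra_primitive (l := a + k.+1%:R^-1)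
  (r := Num.max c c') fg _ _ _ ig.
- by rewrite ltrDl invr_gt0.
- by rewrite gt_max cb c'b.
- move=> x xlr; rewrite /g/= !bump_eq0 ?mulr0 ?addr0//.
    by apply: contra xlr => /andP[->]; rewrite lt_max => ->; rewrite orbT.
  by apply: contra xlr => /andP[->]; rewrite lt_max => ->.
have := wphi _ tphi; rewrite phi1.
have -> : \int[mu]_(x in D) (w x * g x) =
    \int[mu]_(x in D) (m' * (w x * bump k c x) - m * (w x * bump k c' x)).
  apply: eq_Rintegral => x _; rewrite /g/=.
  by move: (bump k c x) (bump k c' x) => B B'; ring.
rewrite (RintegralB mD (iwb m' c) (iwb m c')).
rewrite (RintegralZl m' mD (wbi c)) (RintegralZl m mD (wbi c')) mE m'E.
by move=> /eqP; rewrite subr_eq0 => /eqP.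
Qed.

Lemma weakly_constant_itv w : mu.-integrable D (EFin \o w) ->
  (forall phi, test_function a b phi ->
    \int[mu]_(x in D) (w x * phi^`()%classic x) = 0) ->
  exists C, forall c, D c ->
    \int[mu]_(x in D) (w x * (x \in `]a, c[)%:R) = C * (c - a).
Proof.
move=> wi wphi.
pose W c := \int[mu]_(x in D) (w x * (x \in `]a, c[)%:R).
have key c c' : D c -> D c' -> (c' - a) * W c = (c - a) * W c'.
  move=> Dc Dc'.
  have oi : mu.-integrable D (EFin \o cst 1).
    by apply: sqint_integrable; exact: sqint_cst.
  have lim d d' : D d' ->
      \int[mu]_(x in D) (cst 1 x * bump k d' x) *
      \int[mu]_(x in D) (w x * bump k d x) @[k --> \oo] --> (d' - a) * W d.
    by move=> Dd'; rewrite -(integral_itv_bool Dd'); apply: cvgM; exact: bump_integral_cvg.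
  (* By [weakly_constant_bump] the same sequence has both sides as limits. *)
  apply: (cvg_unique (@Rhausdorff R) (lim c c' Dc')).
  rewrite (_ : (fun k => _) = (fun k => \int[mu]_(x in D) (cst 1 x * bump k c x) *
      \int[mu]_(x in D) (w x * bump k c' x))); first exact: lim.
  by apply/funext => k; exact: weakly_constant_bump.
pose c0 := (a + b) / 2.
have Dc0 : D c0 by rewrite /= in_itv/= !midf_lt.
have c0a : c0 - a != 0.
  by move: Dc0; rewrite /= in_itv/= subr_eq0 => /andP[ac _]; rewrite gt_eqF.
exists (W c0 / (c0 - a)) => c Dc; apply: (mulfI c0a).
by rewrite key// mulrCA mulrA mulrAC -mulrA; field.
Qed.

(** The integral of w - C over every ]a, c[ vanishes, so Lebesgue differentiation gives w = C almost
    everywhere. *)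
Lemma du_bois_reymond w : mu.-integrable D (EFin \o w) ->
  (forall phi, test_function a b phi ->
    \int[mu]_(x in D) (w x * phi^`()%classic x) = 0) ->
  exists C, {ae mu, forall x, D x -> w x = C}.
Proof.
move=> wi /(weakly_constant_itv wi)[C wC]; exists C.
have ci : mu.-integrable D (EFin \o cst C).
  by apply: sqint_integrable; exact: sqint_cst.
pose z x := w x - C.
have zi : mu.-integrable D (EFin \o z) by exact: (integrableB mD wi ci).
pose f := z \_ D.
have fi : mu.-integrable setT (EFin \o f).
  by rewrite -restrict_EFin; apply/integrable_restrict; rewrite ?setTI.
have F0 x : x < b -> \int[mu]_(t in `]-oo, x]) f t = 0.
  move=> xb; have [ax|xa] := ltP a x; last first.
    rewrite (@eq_Rintegral _ _ _ _ _ (cst 0)) ?Rintegral_cst ?mul0r//.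
    move=> t; rewrite inE/= in_itv/= => tx; rewrite /f patchE mem_setE in_itv/=.
    by rewrite ltNge (le_trans tx xa).
  have Dx : D x by rewrite /= in_itv/= ax.
  transitivity (\int[mu]_(t in `]a, x]) z t).
    rewrite [LHS]Rintegral_mkcond [RHS]Rintegral_mkcond.
    apply: eq_Rintegral => t _; rewrite /f !patchE !mem_setE !in_itv/=.
    have [tx|] := leP t x; rewrite ?andbT ?andbF//.
    by rewrite (le_lt_trans tx xb) andbT.
  rewrite -Rintegral_itv_bndo_bndc; last first.
    by apply: integrableS zi => //; apply: subset_itvl; rewrite bnd_simp ltW.
  transitivity (\int[mu]_(t in D) (w t * (t \in `]a, x[)%:R - C * (cst 1 t * (t \in `]a, x[)%:R))).
    rewrite [LHS]Rintegral_mkcond [RHS]Rintegral_mkcond.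
    apply: eq_Rintegral => t _; rewrite !patchE !mem_setE !in_itv/=.
    have [tx|] := ltP t x; rewrite ?andbT ?andbF//=; last by rewrite !mulr0 subr0 if_same.
    rewrite (lt_trans tx xb) andbT; case: ifP => // _.
    by rewrite !mulr1.
  have mb := measurable_itv_bool x.
  have b1 (t : R) : `|(t \in `]a, x[)%:R : R| <= 1.
    by case: (t \in _); rewrite /= ?normr1 ?normr0.
  have oi : mu.-integrable D (EFin \o cst 1).
    by apply: sqint_integrable; exact: sqint_cst.
  have i1 := integrable_mul_bounded oi mb b1.
  rewrite RintegralB//; last 2 first.
  - exact: integrable_mul_bounded.
  - exact: (integrableZl mD _ i1).
  by rewrite (RintegralZl C mD i1) integral_itv_bool// wC// subrr.
have := @FTC1Ny R f _ _.
have fiS y : mu.-integrable `]-oo, y] (EFin \o f) by exact: integrableS fi.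
have fl : locally_integrable [set: R] f.
  by apply: open_integrable_locally => //; exact: openT.
move=> /(_ fiS fl); apply: filterS; first exact: (ae_filter_ringOfSetsType mu).
move=> x [_ Fx] Dx.
apply/eqP; rewrite -subr_eq0; apply/eqP.
have -> : w x - C = f x by rewrite /f patchE mem_set.
(* Since x < b, the primitive of [f] is zero in a neighbourhood of [x]. *)
rewrite -Fx derive1E (@near_eq_derive _ _ _ _ (cst 0)); first exact: derive_cst.
near=> y; apply: F0; near: y; apply: lt_nbhsl.
by move: Dx; rewrite /= in_itv/= => /andP[].
Unshelve. all: by end_near. Qed.

End du_bois_reymond.

(** * Sobolev functions as primitives, and the final estimate *)

Lemma sobolev1_primitive (R : realType) (a b : R) (u v : R -> R) : a < b ->
  sqint lebesgue_measure `]a, b[ u -> sqint lebesgue_measure `]a, b[ v ->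
  weak_derivative a b 1 u v ->
  exists C, {ae lebesgue_measure, forall x, `]a, b[%classic x ->
    u x = C + primitive a b v x}.
Proof.
move=> ab hu hv uv; set mu := lebesgue_measure.
have mD : @measurable _ (measurableTypeR R) `]a, b[ := measurable_itv _.
have hKv := sqint_primitive hv.
have hw := sqintB mD hu hKv.
have [|C wC] := du_bois_reymond ab (sqint_integrable hw).
  move=> phi tphi.
  have h1 := test_function_sqint (test_function_derive1 tphi).
  rewrite -[LHS]/(inner mu `]a, b[ (u \- primitive a b v) (phi^`()%classic)).
  rewrite (innerBl mD hu hKv h1).
  have -> : inner mu `]a, b[ u (phi^`()%classic) = - inner mu `]a, b[ v phi.
    by have := uv _ tphi; rewrite expr1 mulN1r.
  have := primitive_ibp ab 0 tphi hv.
  rewrite (_ : (0 \*o cst 1) \+ primitive a b v = primitive a b v).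
    by move=> ->; rewrite subrr.
  by apply/funext => x /=; rewrite mul0r add0r.
exists C; apply: filterS wC; first exact: (ae_filter_ringOfSetsType mu).
by move=> x + Dx => /(_ Dx) /= <-; rewrite subrK.
Qed.

Theorem theorem1 (R : realType) (a b : R) (hab : a < b) (u : R -> R)
    (hu : sobolev a b 1 u) (h : R) (hh : grid_size a b h)
    (p : nat) (hp : (1 <= p)%N) (hph : h * p%:R < b - a) :
  exists s : R -> R, spline a b p h s /\
    (L2norm a b (fun x => (u x - s x)%R)
       <= (Num.sqrt 2 * h)%:E * sobolev_seminorm a b 1 u)%E.
Proof.
case: hh => h0 [n n0 nE].
have nh : a + h * n%:R = b by rewrite -nE mulrA divff ?gt_eqF// mul1r addrC subrK.
have mD : @measurable _ (measurableTypeR R) `]a, b[ := measurable_itv _.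
case: hu => /L2_sqintP hu /(_ 1%N isT) exv.
(* As [u] is in H^1, the choice in [weakD] is a genuine weak derivative and not the default. *)
have [/L2_sqintP hv uv] : L2 a b (weakD a b 1 u) /\ weak_derivative a b 1 u (weakD a b 1 u).
  exact: (xgetPex (fun=> 0) exv).
rewrite /sobolev_seminorm; move: (weakD _ _ _ _) hv uv => v hv uv {exv}.
have [C uC] := sobolev1_primitive hab hu hv uv.
have hKv := sqint_primitive hv.
have hb := @spline_basis_sqint _ a b h n p.
have [s' ls' orth] := projection mD hb hKv.
have hs' := hb _ ls'.
have bound := spline_projection_bound h0 nh hv ls' orth.
(* The constant of integration is moved into the spline, which is possible because [cst 1] heads the
   basis for p >= 1. *)
pose s := (C \*o cst 1) \+ s'.
have ls : lspan (spline_basis a b h n p) s.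
  case: p hp {hph hb orth bound} ls' => // p _ ls'.
  by apply: lspanD => //; apply: lspanZ; exact: lspan_head.
have hs := hb _ ls.
exists s; split; first exact: (spline_basis_spline hab h0 nh).
have hus := sqintB mD hu hs; have hKs := sqintB mD hKv hs'.
rewrite (L2normE hus) (L2normE hv) -EFinM lee_fin.
have -> : inner lebesgue_measure `]a, b[ (u \- s) (u \- s) =
    inner lebesgue_measure `]a, b[ (primitive a b v \- s') (primitive a b v \- s').
  congr fine; apply: ae_eq_integral => //.
  - by apply/measurable_EFinP; apply: measurable_funM; case: hus.
  - by apply/measurable_EFinP; apply: measurable_funM; case: hKs.
  - apply: filterS uC; first exact: (ae_filter_ringOfSetsType lebesgue_measure).
    move=> x + Dx => /(_ Dx) /= ->; congr EFin.
    have -> : s x = C + s' x by rewrite /s /= mulr1.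
    by rewrite opprD addrACA subrr add0r.
apply: (le_trans (ler_wsqrtr bound)).
rewrite sqrtrM ?sqr_ge0// sqrtr_sqr gtr0_norm// ler_wpM2r ?sqrtr_ge0//.
by rewrite ler_peMl ?(ltW h0)// -[leLHS]sqrtr1 ler_sqrt// ler1n.
Qed.
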